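(* Let $\mathscr{A}$ be a $C^*$-algebra, let $\mathscr{X}$ be a Hilbert $\mathscr{A}$-module, let $x,y_1,\dots,y_n\in\mathscr{X}$ and $a_1,\dots,a_n\in\mathscr{A}$. Then $$\left|\sum_{i=1}^n a_i\langle y_i,x\rangle\right|^2\le |x|^2\left\|\sum_{i=1}^n|a_i^*|^2\right\|^{1/2}\left[\max_{1\le i\le n}\|y_i\|^2\left\|\sum_{i=1}^n|a_i^*|^2\right\|^{1/2}+B_n\right]$$ holds for each of the following two choices of the real number $B_n$: $$B_n=(n-1)\sqrt{n}\,\max_{1\le i\le n}\|a_i\|\,\max_{1\le i\neq j\le n}\|\langle y_i,y_j\rangle\|,$$ and $$B_n=\sqrt{n-1}\left(\max_{1\le i\le n}\sum_{1\le j\neq i\le n}\|\langle y_i,y_j\rangle\|^2\right)^{1/2}\left(\sum_{i=1}^n\|a_i\|^2\right)^{1/2}.$$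
   Context: A Hilbert $\mathscr{A}$-module over a $C^*$-algebra $\mathscr{A}$ is a complex linear space $\mathscr{X}$ that is a right $\mathscr{A}$-module with compatible scalar multiplication ($\lambda(xa)=x(\lambda a)=(\lambda x)a$), equipped with an $\mathscr{A}$-valued inner product $\langle\cdot,\cdot\rangle:\mathscr{X}\times\mathscr{X}\to\mathscr{A}$ satisfying: $\langle x,x\rangle\ge 0$, with $\langle x,x\rangle=0$ iff $x=0$; $\langle x,\lambda y+z\rangle=\lambda\langle x,y\rangle+\langle x,z\rangle$; $\langle x,ya\rangle=\langle x,y\rangle a$; $\langle x,y\rangle^*=\langle y,x\rangle$; and complete for the norm $\|x\|=\|\langle x,x\rangle\|^{1/2}$. (The inner product is thus linear in the second variable and conjugate-linear in the first.) For $x\in\mathscr{X}$, $|x|=\langle x,x\rangle^{1/2}\in\mathscr{A}$; for $a\in\mathscr{A}$, $|a|=(a^*a)^{1/2}$, so $|a^*|^2=aa^*$. Inequalities are in the usual order on self-adjoint elements of $\mathscr{A}$: $a\le b$ iff $b-a$ is positive. For $n=1$ the maximum over the empty set of pairs $i\neq j$ is read as $0$. *)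

(* Defs.v *)
From HB Require Import structures.
From mathcomp Require Import all_boot all_order all_algebra.
From mathcomp Require Import complex.
From mathcomp Require Import all_classical all_reals all_analysis.

Set Implicit Arguments.
Unset Strict Implicit.
Unset Printing Implicit Defensive.

Import Order.TTheory GRing.Theory Num.Theory.
Import numFieldNormedType.Exports.

Local Open Scope ring_scope.
Local Open Scope complex_scope.
Local Open Scope classical_set_scope.

(* No unit is required, so the multiplication cannot be the one of a MathComp
   ring, which always has a 1. *)
HB.mixin Record isCStarAlgebra (R : realType) A
    of CompleteNormedModule R[i] A := {
  cmul : A -> A -> A;
  cstar : A -> A;
  cmulA : forall a b c : A, cmul a (cmul b c) = cmul (cmul a b) c;
  cmulDl : forall a b c : A, cmul (a + b) c = cmul a c + cmul b c;
  cmulDr : forall a b c : A, cmul a (b + c) = cmul a b + cmul a c;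
  cmulZl : forall (l : R[i]) (a b : A), cmul (l *: a) b = l *: cmul a b;
  cmulZr : forall (l : R[i]) (a b : A), cmul a (l *: b) = l *: cmul a b;
  cstarK : forall a : A, cstar (cstar a) = a;
  cstarD : forall a b : A, cstar (a + b) = cstar a + cstar b;
  cstarZ : forall (l : R[i]) (a : A), cstar (l *: a) = l^* *: cstar a;
  cstarM : forall a b : A, cstar (cmul a b) = cmul (cstar b) (cstar a);
  cnormM : forall a b : A, `|cmul a b| <= `|a| * `|b|;
  cnorm_star : forall a : A, `|cmul (cstar a) a| = `|a| ^+ 2
}.

#[short(type="cstarAlgType")]
HB.structure Definition CStarAlgebra (R : realType) :=
  {A of CompleteNormedModule R[i] A & isCStarAlgebra R A}.

(* The positive cone {b^* b}: for C*-algebras this is the set of self-adjoint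
   elements with spectrum in [0, +oo[, and it makes sense without a unit. *)
Definition cpos (R : realType) (A : cstarAlgType R) (a : A) : Prop :=
  exists b : A, a = cmul (cstar b) b.

Definition cle (R : realType) (A : cstarAlgType R) (a b : A) : Prop :=
  cpos (b - a).

(* Only the right action of A and its A-valued inner product are added: the
   library norm of X is forced to be the one induced by the inner product, and
   completeness of X is completeness for that norm. *)
HB.mixin Record isHilbertModule (R : realType) (A : cstarAlgType R) X
    of CompleteNormedModule R[i] X := {
  hact : X -> A -> X;
  hip : X -> X -> A;
  hactDl : forall (x y : X) (a : A), hact (x + y) a = hact x a + hact y a;
  hactDr : forall (x : X) (a b : A), hact x (a + b) = hact x a + hact x b;
  hactM : forall (x : X) (a b : A), hact x (cmul a b) = hact (hact x a) b;
  hactZl : forall (l : R[i]) (x : X) (a : A),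
    l *: hact x a = hact (l *: x) a;
  hactZr : forall (l : R[i]) (x : X) (a : A),
    l *: hact x a = hact x (l *: a);
  hip_ge0 : forall x : X, cpos (hip x x);
  hip_eq0 : forall x : X, hip x x = 0 <-> x = 0;
  hip_linear : forall (l : R[i]) (x y z : X),
    hip x (l *: y + z) = l *: hip x y + hip x z;
  hip_act : forall (x y : X) (a : A), hip x (hact y a) = cmul (hip x y) a;
  hip_star : forall x y : X, cstar (hip x y) = hip y x;
  hnormE : forall x : X, `|x| = sqrtC `|hip x x|
}.

#[short(type="hilbertModType")]
HB.structure Definition HilbertModule (R : realType) (A : cstarAlgType R) :=
  {X of CompleteNormedModule R[i] X & isHilbertModule R A X}.

(* The library norm of a complex normed module takes its values in R[i]. *)
Definition rnorm (R : realType) (V : normedModType R[i]) (v : V) : R :=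
  complex.Re `|v|.

(* Positive p have a unique positive square root, so xget involves no actual
   choice there; the value is 0 if p has none. *)
Definition csqrt (R : realType) (A : cstarAlgType R) (p : A) : A :=
  xget 0 [set b : A | cpos b /\ cmul b b = p].

Definition csq (R : realType) (A : cstarAlgType R) (a : A) : A := cmul a a.

Definition cabs (R : realType) (A : cstarAlgType R) (a : A) : A :=
  csqrt (cmul (cstar a) a).

Definition habs (R : realType) (A : cstarAlgType R) (X : hilbertModType A)
  (x : X) : A := csqrt (hip x x).

(* Main.v *)
Require Import Defs.
From HB Require Import structures.
From mathcomp Require Import all_boot all_order all_algebra.
From mathcomp Require Import complex ring lra.
From mathcomp Require Import all_classical all_reals all_analysis.

Set Implicit Arguments.
Unset Strict Implicit.
Unset Printing Implicit Defensive.

Import Order.TTheory GRing.Theory Num.Theory.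
Import numFieldNormedType.Exports.

Local Open Scope ring_scope.
Local Open Scope complex_scope.

(** Put z = sum y_i a_i^#, with a^# the adjoint of a. Then the sum in the theorem
    is <z, x>, and the Cauchy-Schwarz inequality of a Hilbert module
    ([hip_cauchy_schwarz]) bounds <x, z> <z, x> by K <x, x> as soon as
    |z|^2 <= K. And |z|^2 is the norm of the Gram sum
    sum a_i <y_i, y_j> a_j^# ([rnorm_gram_le]): its diagonal part is dominated by
    max |y_i|^2 times sum a_i a_i^#, and its off-diagonal part has the form
    sum a_i w_i, to which the Cauchy-Schwarz inequality of A^n applies. The two
    values of B come from two estimates of sum |w_i|^2 by B^2: the crude one by
    maxima, and the one given by the scalar Cauchy-Schwarz inequality in each row.

    All this rests on the order of a C*-algebra, developed here from the axioms.
    The cone is defined by the elements b^# b; that it is closed under sums, that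
    its elements have square roots in it and that the norm is monotone on it are
    obtained through a spectral notion of positivity that needs neither spectra
    nor a unit: [npos h] says that h is self-adjoint and that t - h, as a left
    multiplication, has norm at most t for some t > 0. Closure under sums is then
    immediate. Square roots come from the iteration T := (u + T^2) / 2, whose
    fixed point satisfies (1 - T)^2 = 1 - u ([affine_root]); as it has
    nonnegative coefficients, it is majorized by the scalar iteration for u = 1.
    Squares of self-adjoint elements are positive because a self-adjoint
    contraction k extends to a unitary s + i k with s^2 = 1 - k^2
    ([npos_square]). The remaining and deepest point is that every c^# c is
    positive ([npos_starM]), which makes the two notions agree ([cposP]). *)

(** * Linear identities in modules *)

(** Computations in a module and in an algebra without unit end in identities
    between linear combinations. They are settled by reflection: such an
    identity follows from the equality of the coefficients of each atom. *)

Section LinearReflection.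
Variables (S : comPzRingType) (V : lmodType S).

Inductive lexpr :=
  | LVar of nat
  | LZero
  | LAdd of lexpr & lexpr
  | LOpp of lexpr
  | LScale of S & lexpr
  | LMuln of lexpr & nat.

Fixpoint leval (env : seq V) (e : lexpr) : V :=
  match e with
  | LVar n => nth 0 env n
  | LZero => 0
  | LAdd e1 e2 => leval env e1 + leval env e2
  | LOpp e1 => - leval env e1
  | LScale c e1 => c *: leval env e1
  | LMuln e1 n => leval env e1 *+ n
  end.

Fixpoint lcoef (e : lexpr) (k : nat) : S :=
  match e with
  | LVar n => if eqn n k then 1 else 0
  | LZero => 0
  | LAdd e1 e2 => lcoef e1 k + lcoef e2 k
  | LOpp e1 => - lcoef e1 k
  | LScale c e1 => c * lcoef e1 k
  | LMuln e1 n => n%:R * lcoef e1 k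
  end.

Lemma leval_coef env e :
  leval env e = \sum_(k < size env) lcoef e k *: nth 0 env k.
Proof.
elim: e => [n||e1 IH1 e2 IH2|e1 IH1|c e1 IH1|e1 IH1 n] /=.
- have [ltn|gen] := ltnP n (size env).
    rewrite (bigD1 (Ordinal ltn)) //= -[eqn _ _]/(_ == _).
    rewrite eqxx scale1r big1 ?addr0 // => k.
    rewrite -val_eqE /= -[eqn _ _]/(_ == _) eq_sym => /negPf ->.
    by rewrite scale0r.
  rewrite nth_default // big1 // => k _; case: eqnP => [nk|_]; last first.
    by rewrite scale0r.
  by move: gen; rewrite nk leqNgt ltn_ord.
- by rewrite big1 // => k _; rewrite scale0r.
- by rewrite IH1 IH2 -big_split; apply: eq_bigr => k _; rewrite scalerDl.
- by rewrite IH1 -sumrN; apply: eq_bigr => k _; rewrite scaleNr.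
- by rewrite IH1 scaler_sumr; apply: eq_bigr => k _; rewrite scalerA.
- rewrite IH1 -sumrMnl; apply: eq_bigr => k _.
  by rewrite -scalerA scaler_nat.
Qed.

Fixpoint same_coefs (m : nat) (e1 e2 : lexpr) : Prop :=
  if m is m'.+1 then lcoef e1 m' = lcoef e2 m' /\ same_coefs m' e1 e2
  else True.

Lemma leval_eq env e1 e2 :
  same_coefs (size env) e1 e2 -> leval env e1 = leval env e2.
Proof.
move=> same; rewrite !leval_coef; apply: eq_bigr => k _; congr (_ *: _).
case: k => k /= ltk; elim: (size env) ltk same => // m IHm.
rewrite ltnS leq_eqVlt => /orP[/eqP -> [] //|ltk [_]]; exact: IHm.
Qed.

End LinearReflection.

(* The matches on a dummy term below run a tactic while a term is being built,
   so that its failure selects the next branch. *)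
Ltac lin_index v env :=
  lazymatch env with
  | ?w :: ?env' =>
    match constr:(Set) with
    | _ => let _ := match constr:(Set) with _ => constr_eq v w end in
           constr:(0%N)
    | _ => let n := lin_index v env' in constr:(n.+1)
    end
  end.

Ltac lin_add v env :=
  match constr:(Set) with
  | _ => let _ := lin_index v env in env
  | _ => constr:(v :: env)
  end.

Ltac lin_atoms t env :=
  lazymatch t with
  | 0%R => env
  | GRing.add ?a ?b => let env' := lin_atoms a env in lin_atoms b env'
  | GRing.opp ?a => lin_atoms a env
  | GRing.scale _ ?a => lin_atoms a env
  | GRing.natmul ?a _ => lin_atoms a env
  | _ => lin_add t env
  end.

Ltac lin_reify S t env :=
  lazymatch t with
  | 0%R => constr:(@LZero S)
  | GRing.add ?a ?b =>
    let ea := lin_reify S a env in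
    let eb := lin_reify S b env in constr:(LAdd ea eb)
  | GRing.opp ?a => let ea := lin_reify S a env in constr:(LOpp ea)
  | GRing.scale ?c ?a =>
    let ea := lin_reify S a env in constr:(@LScale S c ea)
  | GRing.natmul ?a ?n => let ea := lin_reify S a env in constr:(LMuln ea n)
  | _ => let n := lin_index t env in constr:(@LVar S n)
  end.

(** The argument close settles the coefficient identities: [ring], or [field] in
    the presence of inverses. *)
Ltac linear_in S V close :=
  lazymatch goal with
  | |- ?a = ?b =>
    let env0 := lin_atoms a constr:(@nil V) in
    let env := lin_atoms b env0 in
    let ea := lin_reify S a env in
    let eb := lin_reify S b env in
    refine (@leval_eq S V env ea eb _);
    cbn [same_coefs size lcoef eqn]; repeat split; close
  end.


(** * Real-valued norms and limits with a rate *)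

Section Norm.
Local Open Scope classical_set_scope.
Local Open Scope ring_scope.
Local Open Scope complex_scope.
Variables (R : realType).

Lemma conj_real (r : R) : Num.conj r%:C = r%:C.
Proof. exact: conjc_real. Qed.

Lemma pos_complex_neq0 (r : R) : 0 < r -> r%:C != 0.
Proof. by move=> r_gt0; rewrite fmorph_eq0 gt_eqF. Qed.

Section NormedModule.
Variable V : normedModType R[i].
Implicit Types (v w : V) (r : R).

Lemma normE v : `|v| = (rnorm v)%:C.
Proof. by rewrite /rnorm RRe_real // normr_real. Qed.

Lemma rnorm_ge0 v : 0 <= rnorm v.
Proof. by rewrite -ler0c -normE. Qed.

Lemma rnormD v w : rnorm (v + w) <= rnorm v + rnorm w.
Proof. by rewrite -lecR rmorphD /= -!normE ler_normD. Qed.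

Lemma rnormN v : rnorm (- v) = rnorm v.
Proof. by rewrite /rnorm normrN. Qed.

Lemma rnormBC v w : rnorm (v - w) = rnorm (w - v).
Proof. by rewrite -rnormN opprB. Qed.

Lemma rnorm0 : rnorm (0 : V) = 0.
Proof. by rewrite /rnorm normr0. Qed.

Lemma rnorm_le0 v : rnorm v <= 0 -> v = 0.
Proof.
move=> v_le0; apply/eqP; rewrite -normr_le0 normE.
by rewrite (_ : 0 = 0%:C) // lecR.
Qed.

Lemma rnormZ r v : rnorm (r%:C *: v) = `|r| * rnorm v.
Proof.
apply: (@complexI R); rewrite rmorphM /= -!normE normrZ normc_def /=.
by rewrite expr0n addr0 sqrtr_sqr.
Qed.

Lemma rnormZ_ge0 r v : 0 <= r -> rnorm (r%:C *: v) = r * rnorm v.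
Proof. by move=> r_ge0; rewrite rnormZ ger0_norm. Qed.

Lemma rnorm_sum I (s : seq I) (P : pred I) (F : I -> V) :
  rnorm (\sum_(i <- s | P i) F i) <= \sum_(i <- s | P i) rnorm (F i).
Proof.
elim/big_ind2: _ => [|v r w t vr wt|//]; first by rewrite rnorm0.
exact: le_trans (rnormD _ _) (lerD vr wt).
Qed.

End NormedModule.

(** Every limit taken below has an explicit rate, which lets an identity or a
    bound pass to the limit through [vanishing_le]. *)
Definition vanishing (e : nat -> R) : Prop :=
  forall eps, 0 < eps -> exists n, e n < eps.

Lemma vanishingM c e : 0 <= c -> vanishing e -> vanishing (fun n => c * e n).
Proof.
move=> c_ge0 e0 eps eps_gt0.
have c1 : 0 < c + 1 by lra.
have [n en] := e0 (eps / (c + 1)) (divr_gt0 eps_gt0 c1); exists n.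
have [e_ge0|e_lt0] := leP 0 (e n); last by nra.
move: en; rewrite ltr_pdivlMr //; nra.
Qed.

Lemma vanishing_le x y e :
  vanishing e -> (forall n, x <= y + e n) -> x <= y.
Proof.
move=> e0 xye; rewrite leNgt; apply/negP => ltyx.
have [|n en] := e0 (x - y); first lra.
by have := xye n; lra.
Qed.

Lemma complete_rate (V : completeNormedModType R[i]) (u : nat -> V) e :
    vanishing e -> (forall n m, (n <= m)%N -> rnorm (u m - u n) <= e n) ->
  exists l, forall n, rnorm (l - u n) <= e n.
Proof.
move=> e0 ue.
have u_cauchy : cauchy (u @ \oo).
  apply: cauchy_exP => eps eps_gt0.
  have epsE : eps = (complex.Re eps)%:C by rewrite RRe_real // gtr0_real.
  have [|N eN] := e0 (complex.Re eps).
    by rewrite -ltcR -epsE.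
  exists (u N); exists N => // m /= leNm.
  rewrite -ball_normE /= epsE normE ltcR rnormBC.
  exact: le_lt_trans (ue _ _ leNm) eN.
have /cvg_ex[l ul] : cvg (u @ \oo) by exact/cauchy_cvgP.
exists l => n; apply/ler_addgt0Pr => eps eps_gt0.
have epsc : 0 < eps%:C by rewrite ltcR.
move/cvgrPdist_lt: ul => /(_ _ epsc)[N _ ulN].
have /= := ulN (maxn N n) (leq_maxl _ _); rewrite normE ltcR => lu.
have := ue n (maxn N n) (leq_maxr _ _).
have := rnormD (l - u (maxn N n)) (u (maxn N n) - u n).
by rewrite addrA subrK; lra.
Qed.

End Norm.

(** * Algebra in a C*-algebra without unit *)

Declare Scope cstar_scope.
Delimit Scope cstar_scope with cstar.
Notation "a ** b" := (cmul a b)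
  (at level 40, left associativity) : cstar_scope.
Notation "a ^#" := (cstar a) (at level 2, format "a ^#") : cstar_scope.

Local Open Scope cstar_scope.

Section CStarBasics.
Variables (R : realType) (A : cstarAlgType R).
Implicit Types (a b c x : A) (l : R[i]).

Lemma cmul0l a : 0 ** a = 0.
Proof. by rewrite -(scale0r (0 : A)) cmulZl !scale0r. Qed.

Lemma cmul0r a : a ** 0 = 0.
Proof. by rewrite -(scale0r (0 : A)) cmulZr !scale0r. Qed.

Lemma cmulNl a b : (- a) ** b = - (a ** b).
Proof. by rewrite -(scaleN1r a) cmulZl scaleN1r. Qed.

Lemma cmulNr a b : a ** (- b) = - (a ** b).
Proof. by rewrite -(scaleN1r b) cmulZr scaleN1r. Qed.

Lemma cmulMnl a b n : (a *+ n) ** b = (a ** b) *+ n.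
Proof. by rewrite -[a *+ n]scaler_nat cmulZl scaler_nat. Qed.

Lemma cmulMnr a b n : a ** (b *+ n) = (a ** b) *+ n.
Proof. by rewrite -[b *+ n]scaler_nat cmulZr scaler_nat. Qed.

Lemma cstar0 : (0 : A)^# = 0.
Proof. by apply: (addIr (0 : A)^#); rewrite -cstarD !add0r. Qed.

Lemma cstarN a : (- a)^# = - a^#.
Proof. by apply/eqP; rewrite -addr_eq0 -cstarD addNr cstar0. Qed.

Lemma cstarMn a n : (a *+ n)^# = a^# *+ n.
Proof. by elim: n => [|n IHn]; rewrite ?cstar0 // !mulrS cstarD IHn. Qed.

Lemma cmul_suml I (s : seq I) (P : pred I) (F : I -> A) a :
  (\sum_(i <- s | P i) F i) ** a = \sum_(i <- s | P i) (F i ** a).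
Proof. exact: (big_morph (cmul^~ a) (fun b c => cmulDl b c a) (cmul0l a)). Qed.

Lemma cmul_sumr I (s : seq I) (P : pred I) (F : I -> A) a :
  a ** (\sum_(i <- s | P i) F i) = \sum_(i <- s | P i) (a ** F i).
Proof. exact: (big_morph (cmul a) (cmulDr a) (cmul0r a)). Qed.

Lemma cstar_sum I (s : seq I) (P : pred I) (F : I -> A) :
  (\sum_(i <- s | P i) F i)^# = \sum_(i <- s | P i) (F i)^#.
Proof. exact: (big_morph (@cstar R A) (@cstarD R A) cstar0). Qed.

Definition cstarE :=
  (@cstarD R A, @cstarZ R A, @cstarM R A, @cstarK R A, cstarN, cstarMn, cstar0,
   @conj_real R).

Definition cmulE :=
  (@cmulDl R A, @cmulDr R A, @cmulZl R A, @cmulZr R A, cmulNl, cmulNr,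
   cmulMnl, cmulMnr, cmul0l, cmul0r, @cmulA R A).

Lemma rnormM a b : rnorm (a ** b) <= rnorm a * rnorm b.
Proof. by rewrite -lecR rmorphM /= -!normE cnormM. Qed.

Lemma rnorm_starM a : rnorm (a^# ** a) = rnorm a ^+ 2.
Proof. by apply: (@complexI R); rewrite rmorphXn /= -!normE cnorm_star. Qed.

Lemma rnorm_le_star a : rnorm a <= rnorm a^#.
Proof.
have [->|a_neq0] := eqVneq (rnorm a) 0; first exact: rnorm_ge0.
have a_gt0 : 0 < rnorm a by rewrite lt_def a_neq0 rnorm_ge0.
by rewrite -(ler_pM2r a_gt0) -expr2 -rnorm_starM rnormM.
Qed.

Lemma rnorm_star a : rnorm a^# = rnorm a.
Proof.
by apply/le_anti; rewrite rnorm_le_star -{2}(cstarK a) rnorm_le_star.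
Qed.

Lemma rnorm_Mstar a : rnorm (a ** a^#) = rnorm a ^+ 2.
Proof. by rewrite -{1}(cstarK a) rnorm_starM rnorm_star. Qed.

Lemma starM_eq0 a : a^# ** a = 0 -> a = 0.
Proof.
move=> aa0; apply: rnorm_le0; have := rnorm_starM a.
by rewrite aa0 rnorm0 => /esym/eqP; rewrite sqrf_eq0 => /eqP ->.
Qed.

Lemma rnorm_sq_sa a : a^# = a -> rnorm (a ** a) = rnorm a ^+ 2.
Proof. by move=> sa; rewrite -{1}sa rnorm_starM. Qed.

Lemma sq_sa_eq0 a : a^# = a -> a ** a = 0 -> a = 0.
Proof. by move=> sa aa0; apply: starM_eq0; rewrite sa. Qed.

(** The C*-identity makes the norm of an element that of its left
    multiplication, so norm bounds may be tested on vectors. *)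
Lemma rnorm_le_mul a (k : R) :
  0 <= k -> (forall x, rnorm (a ** x) <= k * rnorm x) -> rnorm a <= k.
Proof.
move=> k_ge0 ak; have := ak a^#; rewrite rnorm_Mstar rnorm_star expr2.
have := rnorm_ge0 a; rewrite le_eqVlt => /orP[/eqP <- //|a_gt0].
by rewrite ler_pM2r.
Qed.

End CStarBasics.

Ltac cexpand := rewrite ?(cstarE, cmulE).
Ltac clinear_by A close :=
  lazymatch type of A with
  | CStarAlgebra.type ?R => linear_in (R[i] : comPzRingType) A close
  end.
Tactic Notation "clinear" constr(A) := clinear_by A ltac:(ring).
Tactic Notation "cfield" constr(A) := clinear_by A ltac:(field).

(** * The iteration for the square root *)

Section Iteration.
Variables (R : realType).

(** 1 - gap n is the n-th iterate of p := (1 + p^2) / 2 from 0, which is the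
    iteration for the square root at the scalar u = 1. *)
Fixpoint gap (n : nat) : R :=
  if n is m.+1 then gap m - gap m ^+ 2 / 2 else 1.

Lemma gap_bound n : 0 <= gap n <= 2 / (n.+2)%:R.
Proof.
elim: n => [|n /andP[IH0 IH1]] /=; first by apply/andP; split; lra.
set g := gap n in IH0 IH1 *; have n0 : 0 <= n%:R :> R by [].
move: IH1; rewrite !ler_pdivlMr ?ltr0n // -(addn3 n) -(addn2 n) !natrD => IH1.
have gn : 0 <= g * n%:R by exact: mulr_ge0.
have g1 : g <= 1 by lra.
have sg : 0 <= (2 - g * (n%:R + 2)) * (1 - g / 2).
  by apply: mulr_ge0; lra.
have gg : 0 <= g * (1 - g / 2) by apply: mulr_ge0; lra.
by have g2 := sqr_ge0 g; apply/andP; split; lra.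
Qed.

Lemma gap_ge0 n : 0 <= gap n.
Proof. by case/andP: (gap_bound n). Qed.

Lemma gap_le n : gap n.+1 <= gap n.
Proof. by rewrite /= gerBl divr_ge0 // sqr_ge0. Qed.

Lemma gap_le1 n : gap n <= 1.
Proof. by elim: n => [|n IHn] //; exact: le_trans (gap_le n) IHn. Qed.

Lemma gap_vanishing : vanishing gap.
Proof.
move=> eps eps_gt0; exists (Num.bound (2 / eps)).
have /andP[_ le_gap] := gap_bound (Num.bound (2 / eps)).
apply: le_lt_trans le_gap _; rewrite ltr_pdivrMr ?ltr0n // mulrC.
rewrite -ltr_pdivrMr //; apply: lt_le_trans (archi_boundP _) _.
  by rewrite divr_ge0 // ltW.
by rewrite ler_nat; exact: leq_trans (leqnSn _) (leqnSn _).
Qed.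

Variable V : normedModType R[i].
Implicit Types (u T S : V -> V) (x v w : V).

Definition additive_map T := forall v w, T (v - w) = T v - T w.
Definition bounded_map (k : R) T := forall x, rnorm (T x) <= k * rnorm x.

Definition root_step u T x : V := (2^-1)%:C *: (u x + T (T x)).

Lemma root_step_additive u T :
  additive_map u -> additive_map T -> additive_map (root_step u T).
Proof.
move=> uB TB v w; rewrite /root_step uB !TB -scalerBr; congr (_ *: _).
by rewrite addrACA opprD.
Qed.

Lemma root_step_bounded u T k :
  bounded_map 1 u -> 0 <= k -> bounded_map k T ->
  bounded_map ((1 + k ^+ 2) / 2) (root_step u T).
Proof.
move=> u1 k_ge0 Tk x; rewrite /root_step rnormZ_ge0 ?invr_ge0 //.
have := rnormD (u x) (T (T x)); have := u1 x; have := Tk (T x).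
have := ler_wpM2l k_ge0 (Tk x); lra.
Qed.

(** The difference of two squares, T T - S S = T (T - S) + (T - S) S, is
    controlled in this form without T and S commuting. *)
Lemma root_step_close u T S k1 k2 d x :
  additive_map T -> 0 <= k1 -> 0 <= d -> bounded_map k1 T -> bounded_map k2 S ->
  (forall v, rnorm (T v - S v) <= d * rnorm v) ->
  rnorm (root_step u T x - root_step u S x) <= (k1 + k2) * d / 2 * rnorm x.
Proof.
move=> TB k1_ge0 d_ge0 T1 S1 TS.
have -> : root_step u T x - root_step u S x =
          (2^-1)%:C *: (T (T x - S x) + (T (S x) - S (S x))).
  by rewrite TB /root_step -scalerBr addrA subrK opprD addrACA subrr add0r.
rewrite rnormZ_ge0 ?invr_ge0 //.
have := rnormD (T (T x - S x)) (T (S x) - S (S x)).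
have := T1 (T x - S x); have := TS (S x).
have := ler_wpM2l k1_ge0 (TS x); have := ler_wpM2l d_ge0 (S1 x); lra.
Qed.

Definition root_orbit u T n : V -> V := iter n (root_step u) T.

(** Started from 0, the iterates are polynomials in u with nonnegative
    coefficients, hence dominated by their values 1 - gap n at u = 1. Started
    from any contraction, the iterates differ from those by polynomials with
    nonnegative coefficients, dominated by their values gap n at 1. *)
Lemma root_orbit_close u T n :
  additive_map u -> bounded_map 1 u -> additive_map T -> bounded_map 1 T ->
  [/\ additive_map (root_orbit u T n), bounded_map 1 (root_orbit u T n),
      bounded_map (1 - gap n) (root_orbit u (fun=> 0) n) &
      forall x, rnorm (root_orbit u T n x - root_orbit u (fun=> 0) n x)
                <= gap n * rnorm x].
Proof.
move=> uB u1 TB T1; elim: n => [|n [IHB IH1 IH0 IHd]] /=.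
  split=> // x; rewrite /root_orbit /= ?rnorm0 ?subrr ?mul0r // subr0.
  exact: T1.
have g0 := gap_ge0 n; have g1 := gap_le1 n.
split=> [|x|x|x].
- exact: root_step_additive.
- have /(_ x) := root_step_bounded u1 ler01 IH1.
  by rewrite expr1n -[1 + 1]/2%:R divff.
- have g1' : 0 <= 1 - gap n by lra.
  have /(_ x) := root_step_bounded u1 g1' IH0.
  by congr (_ <= _ * _); field.
- have /= := @root_step_close u _ _ _ _ _ x IHB ler01 g0 IH1 IH0 IHd.
  by congr (_ <= _ * _); field.
Qed.

(** For n <= m, the m-th iterate is the n-th one from another contraction, and
    both are within gap n of the n-th iterate from 0. *)
Lemma root_orbit_cauchy u T n m x :
  additive_map u -> bounded_map 1 u -> additive_map T -> bounded_map 1 T ->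
  (n <= m)%N ->
  rnorm (root_orbit u T m x - root_orbit u T n x) <= 2 * gap n * rnorm x.
Proof.
move=> uB u1 TB T1 lenm.
have -> : root_orbit u T m = root_orbit u (root_orbit u T (m - n)) n.
  by rewrite /root_orbit -iterD subnKC.
have [kB k1 _ _] := root_orbit_close (m - n) uB u1 TB T1.
have [_ _ _ /(_ x) mP] := root_orbit_close n uB u1 kB k1.
have [_ _ _ /(_ x) nP] := root_orbit_close n uB u1 TB T1.
set P := root_orbit u (fun=> 0) n x in mP nP.
set a := root_orbit u _ n x in mP *; set b := root_orbit u _ n x in nP *.
have := rnormD (a - P) (P - b); rewrite addrA subrK (rnormBC P b); lra.
Qed.

End Iteration.

Section AffineRoot.
Variables (R : realType) (A : cstarAlgType R).
Implicit Types (a b k w x : A).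

Variables (l : bool) (w : A).

Fixpoint affine_iter n : A :=
  if n is m.+1 then
    (2^-1)%:C *: (w + affine_iter m *+ l *+ 2 + affine_iter m ** affine_iter m)
  else 0.

Lemma affine_iterE n x :
  root_orbit (fun x => x *+ l + w ** x) (fun x => x *+ l) n x =
  x *+ l + affine_iter n ** x.
Proof.
elim: n x => [|n IHn] x /=; first by rewrite cmul0l addr0.
rewrite {1}/root_step !IHn; set a := affine_iter n; cexpand.
rewrite -mulrnA; case: l => /=.
  rewrite !mulr1n ?mul1n.
  by cfield A.
rewrite ?mul0n !mulr0n !add0r.
by cfield A.
Qed.

(** The fixed point of the iteration for u = l + w is T = l + a, with
    (1 - T)^2 = 1 - u. For l = true and w = - h this says that a^2 = h; for
    l = false, that (1 - a)^2 = 1 - w. The shift l stands for a multiple of the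
    unit, which keeps a and all its approximations in the algebra. *)
Lemma affine_root :
    w^# = w -> (forall x, rnorm (x *+ l + w ** x) <= rnorm x) ->
  exists a, [/\ a^# = a, a *+ 2 = w + a *+ l *+ 2 + a ** a,
    forall x, rnorm (x *+ l + a ** x) <= rnorm x &
    forall k, k ** w = w ** k -> k ** a = a ** k].
Proof.
move=> w_sa w1; set u := fun x : A => x *+ l + w ** x.
have uB : additive_map u.
  move=> v v'; rewrite /u cmulDr cmulNr mulrnBl opprD !addrA; congr (_ - _).
  by rewrite addrAC.
have u1 : bounded_map 1 u by move=> x; rewrite mul1r; exact: w1.
have lB : additive_map (fun x : A => x *+ l) by move=> v v'; rewrite mulrnBl.
have l1 : bounded_map 1 (fun x : A => x *+ l).
  by move=> x; case: l => /=; rewrite mul1r ?mulr0n ?rnorm0 ?rnorm_ge0.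
pose e n : R := 2 * gap R n.
have e0 : vanishing e by apply: vanishingM => //; exact: gap_vanishing.
have e_ge0 n : 0 <= e n by rewrite mulr_ge0 ?gap_ge0.
have [n m lenm|a ae] := @complete_rate R A affine_iter e e0.
  apply: rnorm_le_mul => // x; rewrite cmulDl cmulNl.
  have := @root_orbit_cauchy R A u _ n m x uB u1 lB l1 lenm.
  rewrite !affine_iterE; congr (rnorm _ <= _).
  by rewrite opprD addrACA subrr add0r.
exists a.
have lim_eq (c : R) b : 0 <= c -> (forall n, rnorm b <= c * e n) -> b = 0.
  move=> c_ge0 bc; apply: rnorm_le0.
  by apply: (vanishing_le (vanishingM c_ge0 e0)) => n; rewrite add0r.
split.
- have iter_sa n : (affine_iter n)^# = affine_iter n.
    elim: n => [|n IHn] /=; first exact: cstar0.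
    by rewrite !cstarE IHn w_sa.
  apply/eqP; rewrite -subr_eq0; apply/eqP; apply: (lim_eq 2) => // n.
  have := rnormD (a - affine_iter n)^# (affine_iter n - a).
  rewrite rnorm_star (rnormBC _ a) cstarD cstarN iter_sa addrA subrK.
  by have := ae n; lra.
- apply/eqP; rewrite -subr_eq0; apply/eqP.
  have an_le n : rnorm (affine_iter n) <= rnorm a + 2.
    have := rnormD (affine_iter n - a) a; rewrite subrK rnormBC.
    by have := ae n; have := gap_le1 R n; rewrite /e; lra.
  (* a *+ 2 - b' *+ 2, with b' the next iterate after b, contributes 2 e n, and
     so does (a - b) *+ l *+ 2; the two products contribute e n times
     |b| + |a| <= 2 |a| + 2. *)
  apply: (lim_eq (6 + 2 * rnorm a)) => [|n].
    by have := rnorm_ge0 a; lra.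
  set b := affine_iter n; set c := affine_iter n.+1.
  have -> : a *+ 2 - (w + a *+ l *+ 2 + a ** a) =
      (a - c) *+ 2 - (a - b) *+ l *+ 2 - (b ** (a - b) + (a - b) ** a).
    rewrite /c /= -/b; cexpand; rewrite -!mulrnA.
    by cfield A.
  have cg : rnorm (a - c) <= 2 * gap R n.
    by apply: le_trans (ae n.+1) _; rewrite ler_pM2l // gap_le.
  have bg : rnorm (a - b) <= 2 * gap R n := ae n.
  have := rnormD ((a - c) *+ 2 - (a - b) *+ l *+ 2)
    (- (b ** (a - b) + (a - b) ** a)).
  have := rnormD ((a - c) *+ 2) (- ((a - b) *+ l *+ 2)).
  have := rnormD (b ** (a - b)) ((a - b) ** a).
  have := rnormM b (a - b); have := rnormM (a - b) a.
  have := rnormD (a - c) (a - c).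
  have := rnormD ((a - b) *+ l) ((a - b) *+ l).
  have := l1 (a - b); rewrite !rnormN !mulr2n mul1r /e.
  have : rnorm b * rnorm (a - b) <= (rnorm a + 2) * (2 * gap R n).
    by apply: ler_pM; rewrite ?rnorm_ge0 ?an_le.
  have : rnorm (a - b) * rnorm a <= 2 * gap R n * rnorm a.
    by apply: ler_wpM2r; rewrite ?rnorm_ge0.
  lra.
- move=> x; apply: (vanishing_le (vanishingM (rnorm_ge0 x) e0)) => n.
  have [_ /(_ x) o1 _ _] := @root_orbit_close R A u _ n uB u1 lB l1.
  move: o1; rewrite affine_iterE mul1r => o1.
  have := rnormD (x *+ l + affine_iter n ** x) ((a - affine_iter n) ** x).
  rewrite -addrA -cmulDl (addrC (affine_iter n)) subrK.
  have := rnormM (a - affine_iter n) x.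
  have := ler_wpM2r (rnorm_ge0 x) (ae n); rewrite addrC; lra.
- move=> k kw.
  have iter_comm n : k ** affine_iter n = affine_iter n ** k.
    elim: n => [|n IHn] /=; first by rewrite cmul0l cmul0r.
    by cexpand; rewrite -!mulrnA kw IHn -(cmulA _ k) IHn cmulA.
  apply/eqP; rewrite -subr_eq0; apply/eqP.
  apply: (lim_eq (2 * rnorm k)) => [|n]; first by rewrite mulr_ge0 ?rnorm_ge0.
  have := rnormD (k ** (a - affine_iter n)) ((affine_iter n - a) ** k).
  have := rnormM k (a - affine_iter n); have := rnormM (affine_iter n - a) k.
  have := ler_wpM2r (rnorm_ge0 k) (ae n); rewrite (rnormBC _ a).
  by cexpand; rewrite iter_comm addrA subrK; lra.
Qed.

End AffineRoot.

(** * Positive elements *)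

Section Positivity.
Variables (R : realType) (A : cstarAlgType R).
Implicit Types (a b c d e f g h k p q x : A) (t : R).

Lemma conj_i : Num.conj ('i : R[i]) = - 'i.
Proof. by apply/eqP; rewrite eq_complex /= oppr0 !eqxx. Qed.

Lemma mul_ii : 'i * 'i = -1 :> R[i].
Proof. by rewrite -expr2 sqr_i. Qed.

(** As a^# b is self-adjoint, w^# w = a^# a + b^# b both for w = a + i b and for
    w = a - i b. So |w|^2 is the right-hand side for both, and a is their
    mean. *)
Lemma rnorm_le_sum_squares a b :
  a^# ** b = b^# ** a -> rnorm a ^+ 2 <= rnorm (a^# ** a + b^# ** b).
Proof.
move=> ab; set s := _ + _.
have norm_i (l : R[i]) : Num.conj l = - l -> l * l = -1 ->
    rnorm (a + l *: b) ^+ 2 = rnorm s.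
  move=> lN ll; rewrite -rnorm_starM; congr rnorm; cexpand.
  rewrite lN ab !scalerA mulNr ll /s.
  by clinear A.
have n1 := norm_i _ conj_i mul_ii.
have n2 : rnorm (a + (- 'i) *: b) ^+ 2 = rnorm s.
  by apply: norm_i; rewrite ?rmorphN /= ?conj_i // mulrNN mul_ii.
have := rnormD (a + 'i *: b) (a + (- 'i) *: b).
have -> : a + 'i *: b + (a + - 'i *: b) = 2%:C *: a by clinear A.
rewrite rnormZ_ge0 // => le2.
have := rnorm_ge0 a; have := rnorm_ge0 (a + 'i *: b).
have := rnorm_ge0 (a + (- 'i) *: b).
have : rnorm (a + 'i *: b) = rnorm (a + (- 'i) *: b).
  by apply/eqP; rewrite -(@eqrXn2 _ 2) ?rnorm_ge0 // n1 n2.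
move: le2; rewrite -n1 => le2 n12 _ n_ge0 a_ge0.
by rewrite ler_pXn2r ?nnegrE //; lra.
Qed.

(** Spectral positivity without a spectrum: t - h has norm at most t as a left
    multiplication, the unit acting as the identity. *)
Definition npos h : Prop :=
  h^# = h /\
  exists2 t, 0 < t & forall x, rnorm (t%:C *: x - h ** x) <= t * rnorm x.

Lemma npos_sa h : npos h -> h^# = h.
Proof. by case. Qed.

Lemma npos0 : npos 0.
Proof.
split; first exact: cstar0.
by exists 1 => // x; rewrite cmul0l subr0 rnormZ_ge0.
Qed.

Lemma nposD h k : npos h -> npos k -> npos (h + k).
Proof.
move=> [h_sa [t t_gt0 ht]] [k_sa [s s_gt0 ks]]; split.
  by rewrite cstarD h_sa k_sa.
exists (t + s) => [|x]; first by rewrite addr_gt0.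
have := rnormD (t%:C *: x - h ** x) (s%:C *: x - k ** x).
have -> : t%:C *: x - h ** x + (s%:C *: x - k ** x) =
          (t + s)%:C *: x - (h + k) ** x by cexpand; clinear A.
by have := ht x; have := ks x; lra.
Qed.

Lemma nposZ r h : 0 <= r -> npos h -> npos (r%:C *: h).
Proof.
rewrite le_eqVlt => /predU1P[<- _|r_gt0]; first by rewrite scale0r; exact: npos0.
move=> [h_sa [t t_gt0 ht]]; split; first by rewrite !cstarE h_sa.
exists (r * t) => [|x]; first exact: mulr_gt0.
have -> : (r * t)%:C *: x - (r%:C *: h) ** x = r%:C *: (t%:C *: x - h ** x).
  by cexpand; clinear A.
by rewrite (rnormZ_ge0 _ (ltW r_gt0)) -mulrA ler_pM2l.
Qed.

Lemma npos_sum I (s : seq I) (P : pred I) (F : I -> A) :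
  (forall i, P i -> npos (F i)) -> npos (\sum_(i <- s | P i) F i).
Proof. by move=> Fpos; elim/big_ind: _ => //; [exact: npos0|exact: nposD]. Qed.

Lemma npos_root h : npos h ->
  exists b, [/\ npos b, b ** b = h & forall k, k ** h = h ** k -> k ** b = b ** k].
Proof.
move=> [h_sa [t t_gt0 ht]]; have t_ge0 := ltW t_gt0.
have tC : (t%:C : R[i]) != 0 by exact: pos_complex_neq0.
have [||a [a_sa a_eq a_le a_comm]] := @affine_root R A true (- ((t^-1)%:C *: h)).
- by rewrite !cstarE h_sa.
- move=> x; have -> : x *+ true + (- ((t^-1)%:C *: h)) ** x =
                      (t^-1)%:C *: (t%:C *: x - h ** x).
    cexpand; rewrite mulr1n rmorphV ?unitfE ?gt_eqF //=.
    by cfield A.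
  rewrite rnormZ_ge0 ?invr_ge0 // mulrC ler_pdivrMr // mulrC.
  exact: ht.
have aa : a ** a = (t^-1)%:C *: h.
  apply: (addrI (- ((t^-1)%:C *: h) + a *+ 2)).
  by move: a_eq; rewrite mulr1n => <-; rewrite addrAC addNr add0r.
have sq : ((Num.sqrt t)%:C * (Num.sqrt t)%:C : R[i]) = t%:C.
  by rewrite -rmorphM /= -expr2 sqr_sqrtr.
exists (- ((Num.sqrt t)%:C *: a)); split.
- split; first by rewrite !cstarE a_sa.
  exists (Num.sqrt t) => [|x]; first by rewrite sqrtr_gt0.
  have -> : (Num.sqrt t)%:C *: x - - ((Num.sqrt t)%:C *: a) ** x =
            (Num.sqrt t)%:C *: (x *+ true + a ** x).
    by cexpand; rewrite mulr1n; clinear A.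
  by rewrite rnormZ_ge0 ?sqrtr_ge0 // ler_wpM2l ?sqrtr_ge0.
- cexpand; rewrite opprK aa !scalerA sq.
  rewrite rmorphV ?unitfE ?gt_eqF //= divff // scale1r //.
- move=> k kh; cexpand; rewrite a_comm //.
  by cexpand; rewrite kh.
Qed.

Lemma contraction_root v : v^# = v -> rnorm v <= 1 ->
  exists r, [/\ r^# = r, r *+ 2 = v + r ** r &
                forall k, k ** v = v ** k -> k ** r = r ** k].
Proof.
move=> v_sa v_le1; have [//||r [r_sa r_eq _ r_comm]] := @affine_root R A false v.
  move=> x; rewrite mulr0n add0r; apply: le_trans (rnormM _ _) _.
  by rewrite ler_piMl ?rnorm_ge0.
by exists r; split=> //; rewrite r_eq mulr0n mul0rn addr0.
Qed.

(** For a self-adjoint contraction k and s = 1 - r with s^2 = 1 - k^2, the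
    element s + i k is unitary, so s, and with it 1 - k^2, is a contraction. *)
Lemma npos_square h : h^# = h -> npos (h ** h).
Proof.
move=> h_sa; set s := rnorm h + 1.
have s_gt0 : 0 < s by have := rnorm_ge0 h; rewrite /s; lra.
have [k [k_sa k_le1 hk]] :
    exists k, [/\ k^# = k, rnorm k <= 1 & h = s%:C *: k].
  exists ((s^-1)%:C *: h); split; first by rewrite !cstarE h_sa.
    by rewrite rnormZ_ge0 ?invr_ge0 ?(ltW s_gt0) // mulrC ler_pdivrMr // mul1r
               lerDl.
  by rewrite scalerA -rmorphM /= divff ?gt_eqF // scale1r.
have [||r [r_sa r_eq r_comm]] := @contraction_root (k ** k).
- by rewrite cstarM k_sa.
- by rewrite rnorm_sq_sa // expr_le1 ?rnorm_ge0.
have kr : k ** r = r ** k by apply: r_comm; rewrite cmulA.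
have rr : r ** r = r *+ 2 - k ** k by rewrite r_eq addrC addKr.
have s_le x : rnorm (x - r ** x) <= rnorm x.
  have := @rnorm_le_sum_squares (x - r ** x) (k ** x).
  have -> : (x - r ** x)^# ** (x - r ** x) + (k ** x)^# ** (k ** x) = x^# ** x.
    cexpand; rewrite r_sa k_sa -(cmulA _ r r) -(cmulA _ k k) rr; cexpand.
    by clinear A.
  rewrite rnorm_starM ler_pXn2r ?nnegrE ?rnorm_ge0 //; apply.
  by cexpand; rewrite r_sa k_sa -(cmulA _ k r) kr; cexpand.
split; first by rewrite cstarM h_sa.
exists (s ^+ 2) => [|x]; first by rewrite exprn_gt0.
have -> : (s ^+ 2)%:C *: x - h ** h ** x =
          (s ^+ 2)%:C *: ((x - r ** x) - r ** (x - r ** x)).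
  by rewrite hk; cexpand; rewrite rr; cexpand; clinear A.
rewrite rnormZ_ge0 ?exprn_ge0 ?(ltW s_gt0) // ler_pM2l ?exprn_gt0 //.
exact: le_trans (s_le _) (s_le _).
Qed.

(** Since f = - b^2, its root c commutes with b, so [rnorm_le_sum_squares]
    applies to b and c. *)
Lemma square_add_npos_eq0 b f : b^# = b -> npos f -> b ** b + f = 0 -> b = 0.
Proof.
move=> b_sa /npos_root[c [/npos_sa c_sa cc c_comm]] bf0.
have fE : f = - (b ** b) by apply/eqP; rewrite -addr_eq0 addrC bf0.
have bc : b ** c = c ** b by apply: c_comm; rewrite fE cmulNr cmulNl cmulA.
have := @rnorm_le_sum_squares b c; rewrite b_sa c_sa cc bf0 rnorm0 => /(_ bc).
move=> b2_le0; apply: rnorm_le0; have := rnorm_ge0 b; nra.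
Qed.

Lemma npos_star_symm g : npos (g^# ** g + g ** g^#).
Proof.
have -> : g^# ** g + g ** g^# = (2^-1)%:C *:
    ((g + g^#) ** (g + g^#) + ('i *: (g - g^#)) ** ('i *: (g - g^#))).
  cexpand; rewrite !(scalerDr, scalerN, scalerA) -!mulrA mul_ii.
  by cfield A.
apply: nposZ; first by rewrite invr_ge0.
apply: nposD; apply: npos_square; first by rewrite !cstarE addrC.
by rewrite !cstarE conj_i scaleNr -scalerN opprB.
Qed.

(** With g = d e one has g^# g = - e^4, and g g^# is minus the square of d d^#,
    while the sum of these two is positive as twice the sum of the squares of the
    real and imaginary parts of g. *)
Lemma starM_neg_square_eq0 d e : e^# = e -> d^# ** d = - (e ** e) -> d = 0.
Proof.
move=> e_sa dd; have ee_sa : (e ** e)^# = e ** e by rewrite cstarM e_sa.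
have dd_sa : (d ** d^#)^# = d ** d^# by rewrite !cstarE.
apply: starM_eq0; rewrite dd.
suff -> : e ** e = 0 by rewrite oppr0.
have := nposD (npos_star_symm (d ** e)) (npos_square dd_sa).
move/(square_add_npos_eq0 ee_sa); apply.
have dde a : a ** d^# ** d = - (a ** e ** e).
  by rewrite -(cmulA a) dd cmulNr cmulA.
cexpand; rewrite e_sa !dde; cexpand.
by clinear A.
Qed.

(** Let k = |h| for h = c^# c and n = k - h, twice the negative part of h. Then
    h n = - k n, so that d = c n has d^# d = n h n = - n k n, minus the square of
    the self-adjoint n q with q the root of k. This forces c n = 0 and then
    n = 0, that is h = |h|. *)
Lemma npos_starM c : npos (c^# ** c).
Proof.
move hE : (c^# ** c) => h.
have h_sa : h^# = h by rewrite -hE !cstarE.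
have [k [k_pos kk k_comm]] := npos_root (npos_square h_sa).
have k_sa := npos_sa k_pos.
have hk : h ** k = k ** h by apply: k_comm; rewrite cmulA.
have [q [q_pos qq q_comm]] := npos_root k_pos.
have q_sa := npos_sa q_pos.
move nE : (k - h) => n.
have n_sa : n^# = n by rewrite -nE cstarD cstarN k_sa h_sa.
have nk : n ** k = k ** n by rewrite -nE; cexpand; rewrite hk.
have nq : n ** q = q ** n by exact: q_comm.
have hn : h ** n = - (k ** n).
  by rewrite -nE; cexpand; rewrite hk kk opprB.
have cn0 : c ** n = 0.
  apply: (@starM_neg_square_eq0 _ (n ** q)); first by rewrite cstarM n_sa q_sa nq.
  rewrite cstarM n_sa !cmulA -(cmulA n) hE -(cmulA n h) hn cmulNr cmulA.
  by rewrite -(cmulA (n ** q)) {2}nq !cmulA -(cmulA n q q) qq.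
have n0 : n = 0.
  apply: sq_sa_eq0 => //; rewrite -{1}nE cmulDl cmulNl.
  have hn0 : h ** n = 0 by rewrite -hE -cmulA cn0 cmul0r.
  by move: hn; rewrite hn0 => /esym/eqP; rewrite oppr_eq0 => /eqP ->; rewrite subr0.
by move/eqP: n0; rewrite -nE subr_eq0 => /eqP <-.
Qed.

Lemma cposP a : cpos a <-> npos a.
Proof.
split=> [[b ->]|]; first exact: npos_starM.
by move=> /npos_root[b [/npos_sa b_sa <- _]]; exists b; rewrite b_sa.
Qed.

Lemma csq_csqrt p : cpos p -> csq (csqrt p) = p.
Proof.
move=> /cposP/npos_root[b [b_pos bb _]].
have := @xgetPex A 0 [set b : A | cpos b /\ b ** b = p].
by case=> //; exists b; split=> //; apply/cposP.
Qed.

Lemma npos_conj g p : npos p -> npos (g^# ** p ** g).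
Proof.
move=> /npos_root[b [/npos_sa b_sa <- _]].
by have := npos_starM (b ** g); rewrite cstarM b_sa !cmulA.
Qed.

(** In the unitization t - v is a positive square t (1 - r)^2, and compressing it
    by g brings it back into the algebra. *)
Lemma npos_compress g v t : v^# = v -> rnorm v <= t ->
  npos (t%:C *: (g^# ** g) - g^# ** v ** g).
Proof.
move=> v_sa v_le; have := le_trans (rnorm_ge0 v) v_le.
rewrite le_eqVlt => /predU1P[t0|t_gt0].
  move: v_le; rewrite -t0 => /rnorm_le0 ->.
  by rewrite cmul0r cmul0l scale0r subrr; exact: npos0.
have t_neq0 : (t%:C : R[i]) != 0 by exact: pos_complex_neq0.
have [||r [r_sa r_eq _]] := @contraction_root ((t^-1)%:C *: v).
- by rewrite !cstarE v_sa.
- by rewrite rnormZ_ge0 ?invr_ge0 ?(ltW t_gt0) // mulrC ler_pdivrMr // mul1r.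
have rr : r ** r = r *+ 2 - (t^-1)%:C *: v by rewrite r_eq addrC addKr.
have -> : t%:C *: (g^# ** g) - g^# ** v ** g =
          t%:C *: ((g - r ** g)^# ** (g - r ** g)).
  cexpand; rewrite r_sa -(cmulA _ r r) rr; cexpand.
  rewrite rmorphV ?unitfE ?gt_eqF //=.
  by cfield A.
by apply: nposZ; [exact: ltW | exact: npos_starM].
Qed.

(** From 0 <= p <= q and T = |q| follows p^2 <= T p, by compressing with the
    root of p. So T p = p^2 + f^2 for some f that commutes with p, and
    |p|^2 <= |p^2 + f^2| = T |p|. *)
Lemma rnorm_mono p q : npos p -> npos (q - p) -> rnorm p <= rnorm q.
Proof.
move=> p_pos qp_pos; have p_sa := npos_sa p_pos.
have q_sa : q^# = q by rewrite -(subrK p q) cstarD p_sa (npos_sa qp_pos).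
set T := rnorm q; have [b [/npos_sa b_sa bb _]] := npos_root p_pos.
have := nposD (npos_compress b q_sa (lexx T)) (npos_conj b qp_pos).
have -> : T%:C *: (b^# ** b) - b^# ** q ** b + b^# ** (q - p) ** b =
          T%:C *: p - p ** p.
  by rewrite b_sa -bb; cexpand; clinear A.
move=> /npos_root[f [/npos_sa f_sa ff f_comm]].
have pf : p ** f = f ** p by apply: f_comm; cexpand.
have := @rnorm_le_sum_squares p f; rewrite p_sa f_sa => /(_ pf).
rewrite ff addrC subrK rnormZ_ge0 ?rnorm_ge0 // expr2.
have := rnorm_ge0 p; rewrite le_eqVlt => /predU1P[<- _|p_gt0].
  exact: rnorm_ge0.
by rewrite ler_pM2r.
Qed.

(** The completion of the square in the Cauchy-Schwarz inequality: the
    hypothesis is the positivity of the square of K x - z g, where G, P and g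
    are the inner products <x, x>, <z, z> and <z, x>. *)
Lemma npos_cauchy_schwarz (G P g : A) (K : R) :
    0 < K -> P^# = P -> rnorm P <= K ->
    npos ((K ^+ 2)%:C *: G - (K *+ 2)%:C *: (g^# ** g) + g^# ** P ** g) ->
  npos (K%:C *: G - g^# ** g).
Proof.
move=> K_gt0 P_sa P_le sq_pos.
have K_neq0 : (K%:C : R[i]) != 0 by exact: pos_complex_neq0.
have Ki_ge0 : 0 <= K^-1 by rewrite invr_ge0 ltW.
have := nposZ Ki_ge0 (nposD sq_pos (npos_compress g P_sa P_le)).
congr npos; rewrite rmorphV ?unitfE ?gt_eqF //=.
by cfield A.
Qed.

End Positivity.

(** * Cauchy-Schwarz inequalities *)

Lemma sum_cauchy_schwarz (R : realType) I (s : seq I) (P : pred I)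
    (u v : I -> R) : (forall i, 0 <= u i) -> (forall i, 0 <= v i) ->
  (\sum_(i <- s | P i) u i * v i) ^+ 2 <=
  (\sum_(i <- s | P i) u i ^+ 2) * (\sum_(i <- s | P i) v i ^+ 2).
Proof.
move=> u_ge0 v_ge0.
pose K (p q r : R) := [/\ 0 <= p, 0 <= q, 0 <= r & r ^+ 2 <= p * q].
suff [] : K (\sum_(i <- s | P i) u i ^+ 2) (\sum_(i <- s | P i) v i ^+ 2)
            (\sum_(i <- s | P i) u i * v i) by [].
(* The elimination abstracts the three sums from right to left, so that of the
   products u i * v i comes first. *)
elim/big_ind3: _ => [|r q p r' q' p'|i _].
- by split; rewrite // expr0n mul0r.
- move=> [p0 q0 r0 rpq] [p0' q0' r0' rpq']; split; rewrite ?addr_ge0 //.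
  have pq_ge0 : 0 <= p * q' by exact: mulr_ge0.
  have pq_ge0' : 0 <= p' * q by exact: mulr_ge0.
  have cross : r * r' *+ 2 <= p * q' + p' * q.
    rewrite -ler_sqr ?nnegrE ?addr_ge0 // ?mulrn_wge0 ?mulr_ge0 //.
    have := ler_pM (sqr_ge0 r) (sqr_ge0 r') rpq rpq'.
    have := sqr_ge0 (p * q' - p' * q); lra.
  lra.
- by split; rewrite ?sqr_ge0 ?mulr_ge0 // exprMn.
Qed.

Section HilbertModules.
Variables (R : realType) (A : cstarAlgType R).

(** The Cauchy-Schwarz inequality of the Hilbert module A^n; the bound is
    proved with each K > |sum a_i a_i^#|, which is nonzero, in place of that
    norm. *)
Lemma rnorm_sum_mul_le n (a w : 'I_n -> A) :
  rnorm (\sum_i a i ** w i) ^+ 2 <=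
  rnorm (\sum_i a i ** (a i)^#) * \sum_i rnorm (w i) ^+ 2.
Proof.
set Z := \sum_i a i ** w i; set P := \sum_i a i ** (a i)^#.
set C := \sum_i _ ^+ 2.
have C_ge0 : 0 <= C by apply: sumr_ge0 => i _; exact: sqr_ge0.
have P_sa : P^# = P.
  by rewrite cstar_sum; apply: eq_bigr => i _; rewrite !cstarE.
have above_norm K : rnorm P < K -> rnorm Z ^+ 2 <= K * C.
  move=> PK; have K_gt0 : 0 < K := le_lt_trans (rnorm_ge0 _) PK.
  have ZE : Z^# = \sum_i (w i)^# ** (a i)^#.
    by rewrite cstar_sum; apply: eq_bigr => i _; rewrite cstarM.
  set W := \sum_i (w i)^# ** w i.
  have KC : npos (K%:C *: W - Z^# ** Z).
    apply: (npos_cauchy_schwarz K_gt0 P_sa (ltW PK)).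
    rewrite (_ : _ + _ = \sum_i (K%:C *: w i - (a i)^# ** Z)^# **
                               (K%:C *: w i - (a i)^# ** Z)).
      by apply: npos_sum => i _; exact: npos_starM.
    transitivity (\sum_i ((K ^+ 2)%:C *: ((w i)^# ** w i)
        - K%:C *: ((w i)^# ** (a i)^# ** Z) - K%:C *: (Z^# ** (a i ** w i))
        + Z^# ** (a i ** (a i)^#) ** Z)); last first.
      by apply: eq_bigr => i _; cexpand; clinear A.
    rewrite !big_split /= !sumrN -!scaler_sumr -!cmul_suml -!cmul_sumr.
    by rewrite -ZE -/Z -/P -/W; clinear A.
  rewrite -rnorm_starM.
  have /rnorm_mono := npos_starM Z; move/(_ _ KC) => /le_trans; apply.
  rewrite rnormZ_ge0 ?(ltW K_gt0) // ler_pM2l //.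
  apply: le_trans (rnorm_sum _ _ _) _; apply: ler_sum => i _.
  by rewrite rnorm_starM.
apply/ler_addgt0Pr => eps eps_gt0.
have C1 : 0 < C + 1 by lra.
have d_gt0 : 0 < eps / (C + 1) by exact: divr_gt0.
apply: le_trans (above_norm (rnorm P + eps / (C + 1)) _) _; first lra.
rewrite mulrDl lerD2l mulrAC ler_pdivrMr // ler_pM2l //; lra.
Qed.

Variable X : hilbertModType A.
Implicit Types (x y z : X) (a b : A).

Lemma hipDr x y z : hip x (y + z) = hip x y + hip x z.
Proof. by rewrite -[y]scale1r hip_linear !scale1r. Qed.

Lemma hip0r x : hip x 0 = 0.
Proof. by apply: (addrI (hip x 0)); rewrite -hipDr !addr0. Qed.

Lemma hipZr (l : R[i]) x y : hip x (l *: y) = l *: hip x y.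
Proof. by rewrite -[l *: y]addr0 hip_linear hip0r addr0. Qed.

Lemma hipNr x y : hip x (- y) = - hip x y.
Proof. by rewrite -scaleN1r hipZr scaleN1r. Qed.

Lemma hipDl x y z : hip (x + y) z = hip x z + hip y z.
Proof. by rewrite -hip_star hipDr cstarD !hip_star. Qed.

Lemma hip0l x : hip 0 x = 0.
Proof. by rewrite -hip_star hip0r cstar0. Qed.

Lemma hipNl x y : hip (- x) y = - hip x y.
Proof. by rewrite -hip_star hipNr cstarN hip_star. Qed.

Lemma hipZl_real (r : R) x y : hip (r%:C *: x) y = r%:C *: hip x y.
Proof. by rewrite -hip_star hipZr cstarZ conj_real hip_star. Qed.

Lemma hip_actl x y a : hip (hact x a) y = a^# ** hip x y.
Proof. by rewrite -hip_star hip_act cstarM hip_star. Qed.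

Lemma hip_suml I (s : seq I) (P : pred I) (F : I -> X) x :
  hip (\sum_(i <- s | P i) F i) x = \sum_(i <- s | P i) hip (F i) x.
Proof. exact: (big_morph (fun y => hip y x) (fun y z => hipDl y z x) (hip0l x)). Qed.

Lemma hip_sumr I (s : seq I) (P : pred I) (F : I -> X) x :
  hip x (\sum_(i <- s | P i) F i) = \sum_(i <- s | P i) hip x (F i).
Proof. exact: (big_morph (hip x) (hipDr x) (hip0r x)). Qed.

Lemma rnorm_hip x : rnorm (hip x x) = rnorm x ^+ 2.
Proof. by apply: (@complexI R); rewrite rmorphXn /= -!normE hnormE sqrtCK. Qed.

Lemma hip_cauchy_schwarz x z (K : R) : rnorm z ^+ 2 <= K ->
  npos (K%:C *: hip x x - (hip z x)^# ** hip z x).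
Proof.
move=> zK; have := le_trans (sqr_ge0 _) zK.
rewrite le_eqVlt => /predU1P[K0|K_gt0].
  have z0 : z = 0.
    apply: rnorm_le0; move: zK; rewrite -K0 => zK.
    by have := rnorm_ge0 z; nra.
  by rewrite -K0 z0 hip0l cmul0r scale0r subr0; exact: npos0.
apply: (npos_cauchy_schwarz (P := hip z z)) => //.
- by rewrite hip_star.
- by rewrite rnorm_hip.
set w := K%:C *: x - hact z (hip z x).
rewrite (_ : _ + _ = hip w w); first exact/cposP/hip_ge0.
rewrite /w !(hipDl, hipDr, hipNl, hipNr, hipZr, hipZl_real, hip_act, hip_actl).
rewrite -(hip_star z x); cexpand; clinear A.
Qed.

(** The diagonal of the Gram sum of sum y_i a_i^# is at most c sum a_i a_i^#,
    and the rest is sum a_i w_i with w_i the off-diagonal part of the i-th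
    row. *)
Lemma rnorm_gram_le n (y : 'I_n -> X) (a : 'I_n -> A) (c B : R) :
  let S := rnorm (\sum_i a i ** (a i)^#) in
  (forall i, rnorm (y i) ^+ 2 <= c) -> 0 <= c -> 0 <= B ->
  \sum_i rnorm (\sum_(j | j != i) hip (y i) (y j) ** (a j)^#) ^+ 2 <= B ^+ 2 ->
  rnorm (\sum_i hact (y i) (a i)^#) ^+ 2 <=
    Num.sqrt S * (c * Num.sqrt S + B).
Proof.
move=> S yc c_ge0 B_ge0.
pose w i := \sum_(j | j != i) hip (y i) (y j) ** (a j)^#.
move=> wB; have {}wB : \sum_i rnorm (w i) ^+ 2 <= B ^+ 2 by [].
set z := \sum_i _.
have S_ge0 : 0 <= S by exact: rnorm_ge0.
set D := \sum_i a i ** hip (y i) (y i) ** (a i)^#.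
have zz : hip z z = D + \sum_i a i ** w i.
  rewrite /z hip_suml -big_split; apply: eq_bigr => i _ /=.
  rewrite hip_actl cstarK hip_sumr (bigD1 i) //= cmulDr hip_act cmulA.
  by congr (_ + _ ** _); apply: eq_bigr => j _; rewrite hip_act.
have D_le : rnorm D <= c * S.
  rewrite -rnormZ_ge0 //; apply: rnorm_mono.
    apply: npos_sum => i _; have /cposP yy_pos := hip_ge0 (y i).
    have := npos_conj (a i)^# yy_pos.
    by rewrite cstarK.
  rewrite scaler_sumr -sumrB; apply: npos_sum => i _.
  have := @npos_compress R A (a i)^# (hip (y i) (y i)) c.
  by rewrite cstarK; apply; rewrite ?hip_star // rnorm_hip.
have W_le : rnorm (\sum_i a i ** w i) <= Num.sqrt S * B.
  rewrite -ler_sqr ?nnegrE ?mulr_ge0 ?sqrtr_ge0 ?rnorm_ge0 //.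
  rewrite exprMn sqr_sqrtr //; apply: le_trans (rnorm_sum_mul_le _ _) _.
  by rewrite ler_wpM2l.
rewrite -rnorm_hip zz; apply: le_trans (rnormD _ _) _.
rewrite mulrDr; apply: lerD => //.
by rewrite mulrCA -expr2 sqr_sqrtr.
Qed.

End HilbertModules.

(** * The two bounds on the off-diagonal part *)

Section OffDiagonal.
Variables (R : realType) (A : cstarAlgType R) (n : nat).
Variables (G : 'I_n -> 'I_n -> A) (a : 'I_n -> A).

Lemma sum_neq_const (r : R) (i : 'I_n) : \sum_(j < n | j != i) r = (n%:R - 1) * r.
Proof.
rewrite sumr_const cardC1 card_ord -[LHS]mulr_natl; congr (_ * _).
by case: n i => [[]//|m i]; rewrite -natr1 addrK.
Qed.

Lemma rnorm_row_le i :
  rnorm (\sum_(j < n | j != i) G i j ** (a j)^#) <=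
  \sum_(j < n | j != i) rnorm (G i j) * rnorm (a j).
Proof.
apply: le_trans (rnorm_sum _ _ _) _; apply: ler_sum => j _.
by rewrite -(rnorm_star (a j)) rnormM.
Qed.

Lemma off_diagonal_max :
  \sum_(i < n) rnorm (\sum_(j < n | j != i) G i j ** (a j)^#) ^+ 2 <=
  ((n%:R - 1) * Num.sqrt n%:R * \big[Num.max/0]_(i < n) rnorm (a i)
   * \big[Num.max/0]_(p : 'I_n * 'I_n | p.1 != p.2) rnorm (G p.1 p.2)) ^+ 2.
Proof.
set M := \big[Num.max/0]_(i < n) _; set N := \big[Num.max/0]_(p | _) _.
have M_ge0 : 0 <= M by exact: bigmax_ge_id.
have N_ge0 : 0 <= N by exact: bigmax_ge_id.
have -> : ((n%:R - 1) * Num.sqrt n%:R * M * N) ^+ 2 =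
          \sum_(i < n) ((n%:R - 1) * (N * M)) ^+ 2.
  rewrite sumr_const card_ord -[RHS]mulr_natl !exprMn sqr_sqrtr //; ring.
apply: ler_sum => i _; rewrite lerXn2r ?nnegrE ?rnorm_ge0 //.
  by rewrite -(sum_neq_const _ i); apply: sumr_ge0 => j _; exact: mulr_ge0.
apply: le_trans (rnorm_row_le i) _; rewrite -(sum_neq_const _ i).
apply: ler_sum => j ji; apply: ler_pM; rewrite ?rnorm_ge0 //.
  apply: (le_bigmax_cond 0 (fun p => rnorm (G p.1 p.2)) (j := (i, j))).
  by rewrite /= eq_sym.
exact: (le_bigmax 0 (fun i => rnorm (a i))).
Qed.

(** The sum over i of the sums of |a_j|^2 over j != i counts each |a_j|^2
    exactly n - 1 times, whence the factor. *)
Lemma off_diagonal_hilbert_schmidt :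
  \sum_(i < n) rnorm (\sum_(j < n | j != i) G i j ** (a j)^#) ^+ 2 <=
  (Num.sqrt (n%:R - 1)
   * Num.sqrt (\big[Num.max/0]_(i < n) \sum_(j < n | j != i) rnorm (G i j) ^+ 2)
   * Num.sqrt (\sum_(i < n) rnorm (a i) ^+ 2)) ^+ 2.
Proof.
set N := \big[Num.max/0]_(i < n) _; set C := \sum_(i < n) rnorm (a i) ^+ 2.
have N_ge0 : 0 <= N by exact: bigmax_ge_id.
have C_ge0 : 0 <= C by apply: sumr_ge0 => i _; exact: sqr_ge0.
have [n0|n_gt0] := posnP n.
  rewrite big1 ?sqr_ge0 // => i; by have := ltn_ord i; rewrite {2}n0.
have n1_ge0 : 0 <= n%:R - 1 :> R by rewrite subr_ge0 ler1n.
rewrite !exprMn !sqr_sqrtr //.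
apply: (@le_trans _ _ (\sum_(i < n) N * \sum_(j < n | j != i) rnorm (a j) ^+ 2)).
  apply: ler_sum => i _.
  apply: (@le_trans _ _ ((\sum_(j < n | j != i) rnorm (G i j) * rnorm (a j)) ^+ 2)).
    rewrite lerXn2r ?nnegrE ?rnorm_ge0 ?rnorm_row_le //.
    by apply: sumr_ge0 => j _; rewrite mulr_ge0 ?rnorm_ge0.
  apply: le_trans (sum_cauchy_schwarz _ _ (fun j => rnorm_ge0 (G i j))
                                          (fun j => rnorm_ge0 (a j))) _.
  apply: ler_wpM2r; first by apply: sumr_ge0 => j _; exact: sqr_ge0.
  exact: (le_bigmax 0 (fun i => \sum_(j < n | j != i) rnorm (G i j) ^+ 2)).
rewrite -mulr_sumr (exchange_big_dep predT) //= [(_ - 1) * N]mulrC -mulrA.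
rewrite ler_wpM2l // /C mulr_sumr; apply: ler_sum => j _.
by under eq_bigl => i do rewrite eq_sym; rewrite sum_neq_const.
Qed.

End OffDiagonal.

Theorem theorem3p11 (R : realType) (A : cstarAlgType R) (X : hilbertModType A)
    (n : nat) (hn : (0 < n)%N) (x : X) (y : 'I_n -> X) (a : 'I_n -> A) (B : R) :
  (B = (n%:R - 1) * Num.sqrt n%:R
       * \big[Num.max/0]_(i < n) rnorm (a i)
       * \big[Num.max/0]_(p : 'I_n * 'I_n | p.1 != p.2)
           rnorm (hip (y p.1) (y p.2))
   \/
   B = Num.sqrt (n%:R - 1)
       * Num.sqrt (\big[Num.max/0]_(i < n)
                     \sum_(j < n | j != i) rnorm (hip (y i) (y j)) ^+ 2)
       * Num.sqrt (\sum_(i < n) rnorm (a i) ^+ 2)) ->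
  cle (csq (cabs (\sum_(i < n) cmul (a i) (hip (y i) x))))
      ((Num.sqrt (rnorm (\sum_(i < n) csq (cabs (cstar (a i)))))
        * (\big[Num.max/0]_(i < n) rnorm (y i) ^+ 2
           * Num.sqrt (rnorm (\sum_(i < n) csq (cabs (cstar (a i))))) + B))%:C
       *: csq (habs x)).
Proof.
move=> B_def.
have B_ge0 : 0 <= B.
  have n1_ge0 : 0 <= n%:R - 1 :> R by rewrite subr_ge0 ler1n.
  by case: B_def => ->; rewrite !mulr_ge0 ?sqrtr_ge0 ?bigmax_ge_id.
have B_bound :
    \sum_i rnorm (\sum_(j | j != i) hip (y i) (y j) ** (a j)^#) ^+ 2 <= B ^+ 2.
  case: B_def => ->; first exact: off_diagonal_max.
  exact: off_diagonal_hilbert_schmidt.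
have absE b : csq (cabs b) = b^# ** b by apply: csq_csqrt; exists b.
have habsE : csq (habs x) = hip x x by apply: csq_csqrt; exact: hip_ge0.
have -> : \sum_(i < n) csq (cabs (cstar (a i))) = \sum_i a i ** (a i)^#.
  by apply: eq_bigr => i _; rewrite absE cstarK.
have -> : \sum_(i < n) cmul (a i) (hip (y i) x) =
          hip (\sum_i hact (y i) (a i)^#) x.
  by rewrite hip_suml; apply: eq_bigr => i _; rewrite hip_actl cstarK.
rewrite absE habsE; apply/cposP/hip_cauchy_schwarz/rnorm_gram_le => //.
- by move=> i; exact: (le_bigmax 0 (fun i => rnorm (y i) ^+ 2)).
- exact: bigmax_ge_id.
Qed.
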